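(* Let $n\geq 2$ be an integer and let $X$ be an $n$-Urysohn locally $n$-H-closed topological space. Then $|X|\leq wL(X)^{\chi(X)}$.
   Context: Throughout $n\ge 2$ is an integer. The Hausdorff number $H(X)$ (resp. Urysohn number $U(X)$) of a space $X$ is the least cardinal $\kappa$ such that for every $A\subseteq X$ with $|A|\geq\kappa$ there exist open neighbourhoods $U_a$ of $a$ ($a\in A$) with $\bigcap_{a\in A}U_a=\emptyset$ (resp. $\bigcap_{a\in A}\overline{U_a}=\emptyset$). $X$ is $n$-Hausdorff if $H(X)\leq n$, and $n$-Urysohn if $U(X)\leq n$. An $n$-Hausdorff space is called $n$-H-closed if it is closed in every $n$-Hausdorff space in which it is embedded. A space is locally $n$-H-closed if every point has an open neighbourhood whose closure is $n$-H-closed. The weak Lindelöf degree $wL(X)$ is the minimum cardinal $\kappa$ such that every open cover $\mathcal{U}$ of $X$ has a subfamily $\mathcal{V}$ with $|\mathcal{V}|\leq\kappa$ and $X=\overline{\bigcup\mathcal{V}}$. $\chi(X)$ is the character of $X$. Both $wL(X)$ and $\chi(X)$ are multiplied by $\omega$ (so they are always infinite). *)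

(* Defs.v *)
From mathcomp Require Import all_boot all_classical topology.

Set Implicit Arguments.
Unset Strict Implicit.
Unset Printing Implicit Defensive.

Local Open Scope classical_set_scope.
Local Open Scope card_scope.

(* Cardinals are represented by types, compared by [set: K] #<= [set: L]
   (existence of an injection K -> L); a cardinal is thus determined only up to
   bijection.  The cardinal power L ^ K is the function type K -> L. *)

(* Cardinals being well-ordered, least_card P is characterised by least_cardP
   as soon as P holds of some type. *)
Definition is_least_card (P : Type -> Prop) (K : Type) : Prop :=
  P K /\ forall L : Type, P L -> [set: K] #<= [set: L].

Definition least_card (P : Type -> Prop) : Type :=
  if pselect (exists K, is_least_card P K) is left exK then projT1 (cid exK)
  else unit.

Lemma setT_card_leP (T U : Type) :
  ([set: T] #<= [set: U]) <-> exists f : T -> U, injective f.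
Proof.
split=> [/card_leP[f]|[f finj]].
- exists (fun x => val (f (SigSub (mem_set (I : [set: T] x))))) => x y /val_inj.
  move=> /(@inj _ _ _ f); rewrite !in_setT => /(_ isT isT).
  by move=> /(congr1 val).
- have fs : set_fun [set: T] [set: U] f by [].
  have fi : set_inj [set: T] f by move=> x y _ _ /finj.
  by have [g] := (injfunPex.2 (ex_intro2 _ _ f fs fi)); exact: inj_card_le g.
Qed.

Lemma family_least_card (J : Type) (F : J -> Type) (j0 : J) :
  exists i, forall j, [set: F i] #<= [set: F j].
Proof.
pose T := forall j : J, F j.
pose Inj (S : set T) := forall (j : J) (s t : T), S s -> S t -> s j = t j -> s = t.
have [G GInj Gtot|S [SInj Smax]] := @Zorn_bigcup T [set S | Inj S].
  move=> j s t [A GA As] [B GB Bt].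
  by have [AB|BA] := Gtot _ _ GA GB;
    [apply: (GInj _ GB j s t) => //; exact: AB
    |apply: (GInj _ GA j s t) => //; exact: BA].
have [i Si] : exists i : J, forall y : F i, exists s, S s /\ s i = y.
  apply: contrapT => /forallNP nS.
  have /all_tag[x xP] (i : J) : {y : F i | ~ exists s, S s /\ s i = y}.
    by apply: cid; apply: contrapT => /forallNP H; apply: (nS i) => y;
      apply: contrapT; exact: H.
  have nSx : ~ S x by move=> Sx; apply: (xP j0); exists x.
  apply: (Smax (S `|` [set x])).
    by split=> [s|/(_ x (or_intror erefl))//]; left.
  move=> j s t [Ss|->] [St|->] // st; first exact: SInj st.
  - by case: (xP j); exists s.
  - by case: (xP j); exists t.
exists i => j; have [g gP] := choice Si.
apply/setT_card_leP; exists (fun y => g y j) => y z gyz.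
have e := SInj j _ _ (gP y).1 (gP z).1 gyz.
by rewrite -[y](gP y).2 -[z](gP z).2 e.
Qed.

Lemma setT_card_le_total (K L : Type) :
  [set: K] #<= [set: L] \/ [set: L] #<= [set: K].
Proof.
have [[] le] := @family_least_card bool (fun b => if b then K else L) true.
- by left; exact: (le false).
- by right; exact: (le true).
Qed.

(* The comparison goes through subsets of a fixed K0 satisfying P, which keeps
   the argument in the universe of K0. *)
Lemma least_cardP (P : Type -> Prop) :
  (exists K, P K) -> is_least_card P (least_card P).
Proof.
move=> [K0 PK0]; rewrite /least_card; case: pselect => [exK|nex].
  by case: (cid exK).
exfalso; apply: nex.
pose Q (A : set K0) := exists2 K : Type, P K & A #= [set: K].
have Q0 : Q setT by exists K0.
have [[A [K PK AK]] le] :=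
  @family_least_card {A : set K0 | Q A} (fun i => set_type (sval i))
    (exist _ setT Q0).
have leA (B : set K0) : Q B -> [set: K] #<= B.
  move=> QB; have /= := le (exist _ B QB).
  by rewrite (card_le_eqr (card_setT _)) (card_le_eql (card_setT _))
    (card_le_eql AK).
exists K; split=> // L PL.
have [/setT_card_leP[f finj]|L0] := setT_card_le_total L K0; last first.
  exact: card_le_trans (leA _ Q0) L0.
have fL : range f #= [set: L] by apply: inj_card_eq => x y _ _ /finj.
by rewrite -(card_le_eqr fL); apply: leA; exists L.
Qed.

Section CardinalFunctions.
Variable X : topologicalType.

Definition hausdorff_bound (K : Type) : Prop :=
  forall A : set X, [set: K] #<= A ->
  exists2 U : X -> set X, (forall a, A a -> open_nbhs a (U a)) &
    \bigcap_(a in A) U a = set0.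

Definition hausdorff_number : Type := least_card hausdorff_bound.

Definition urysohn_bound (K : Type) : Prop :=
  forall A : set X, [set: K] #<= A ->
  exists2 U : X -> set X, (forall a, A a -> open_nbhs a (U a)) &
    \bigcap_(a in A) closure (U a) = set0.

Definition urysohn_number : Type := least_card urysohn_bound.

(* Multiplying a cardinal invariant by omega is rendered by taking the least
   infinite cardinal with the defining property, i.e. max(kappa, omega) when
   kappa is the least cardinal with this property. *)
Definition weak_lindelof_bound (K : Type) : Prop :=
  forall U : set (set X), U `<=` open -> cover U id = setT ->
  exists V : set (set X),
    [/\ V `<=` U, V #<= [set: K] & closure (cover V id) = setT].

Definition weak_lindelof_degree : Type :=
  least_card (fun K => infinite_set [set: K] /\ weak_lindelof_bound K).

Definition local_base (x : X) (B : set (set X)) : Prop :=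
  B `<=` open_nbhs x /\
  forall N : set X, nbhs x N -> exists2 W, B W & W `<=` N.

Definition character_at_bound (x : X) (K : Type) : Prop :=
  exists2 B : set (set X), local_base x B & B #<= [set: K].

Definition character_at (x : X) : Type := least_card (character_at_bound x).

(* omega times the supremum of the characters at the points of X *)
Definition character_bound (K : Type) : Prop :=
  forall x : X, [set: character_at x] #<= [set: K].

Definition character : Type :=
  least_card (fun K => infinite_set [set: K] /\ character_bound K).

End CardinalFunctions.

Definition n_Hausdorff (n : nat) (X : topologicalType) : Prop :=
  [set: hausdorff_number X] #<= `I_n.

Definition n_Urysohn (n : nat) (X : topologicalType) : Prop :=
  [set: urysohn_number X] #<= `I_n.

Definition embedding (X Y : topologicalType) (f : X -> Y) : Prop :=
  injective f /\
  forall U : set X, open U <-> exists2 V : set Y, open V & U = f @^-1` V.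

Definition n_H_closed (n : nat) (X : topologicalType) : Prop :=
  n_Hausdorff n X /\
  forall (Y : topologicalType) (f : X -> Y),
    n_Hausdorff n Y -> embedding f -> closed (range f).

(* set_type A carries the relative (initial) topology of A. *)
Definition locally_n_H_closed (n : nat) (X : topologicalType) : Prop :=
  forall x : X, exists2 U : set X, open_nbhs x U &
    n_H_closed n (set_type (closure U)).

(* The sets of cardinals whose minima define the invariants are nonempty. *)

Section CardinalFunctionsSpec.
Variable X : topologicalType.

Let not_set_card_le (A : set X) : ~ ([set: set X] #<= A).
Proof.
move=> /(card_le_trans)/(_ (subset_card_le (@subsetT _ A))).
move=> /setT_card_leP[f finj].
pose D := [set f B | B in [set B : set X | ~ B (f B)]].
have nD : ~ D (f D) by move=> DfD; case: (DfD) => B nB /finj BD; rewrite BD in nB.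
by apply: (nD); exists D.
Qed.

Let infinite_sum_nat : infinite_set [set: (set X + nat)%type].
Proof. by apply/infiniteP/setT_card_leP; exists inr => x y []. Qed.

Let card_le_sum (B : set (set X)) : B #<= [set: (set X + nat)%type].
Proof.
apply: (card_le_trans (subset_card_le (@subsetT _ B))).
by apply/setT_card_leP; exists inl => x y [].
Qed.

Lemma hausdorff_numberP :
  is_least_card (@hausdorff_bound X) (hausdorff_number X).
Proof. by apply: least_cardP; exists (set X) => A /not_set_card_le. Qed.

Lemma urysohn_numberP : is_least_card (@urysohn_bound X) (urysohn_number X).
Proof. by apply: least_cardP; exists (set X) => A /not_set_card_le. Qed.

Lemma weak_lindelof_degreeP :
  is_least_card (fun K => infinite_set [set: K] /\ weak_lindelof_bound X K)
    (weak_lindelof_degree X).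
Proof.
apply: least_cardP; exists (set X + nat)%type; split=> // U Uo Ucov.
by exists U; split=> //; rewrite Ucov closureT.
Qed.

Lemma character_atP (x : X) :
  is_least_card (character_at_bound x) (character_at x).
Proof.
apply: least_cardP; exists (set X), (open_nbhs x).
  by split=> // N; rewrite nbhsE => -[W]; exists W.
exact: subset_card_le.
Qed.

Lemma characterP :
  is_least_card (fun K => infinite_set [set: K] /\ character_bound X K)
    (character X).
Proof.
apply: least_cardP; exists (set X + nat)%type; split=> // x.
have [_ + ] := character_atP x; apply; exists (open_nbhs x) => //.
by split=> // N; rewrite nbhsE => -[W]; exists W.
Qed.

End CardinalFunctionsSpec.

(* Main.v *)
From HB Require Import structures.
Require Import Defs.
From mathcomp Require Import all_boot all_classical topology.

(** Write [kappa] for the character of [X] and [lambda] for its weak Lindelof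
    degree; both are infinite, and [kappa -> lambda] is the power
    lambda ^ kappa.

    Local part.  Let [K] be n-H-closed and n-Urysohn.  An open ultrafilter of
    [K] has at least n - 1 limits: otherwise adjoining it to [K] as a new point
    yields an n-Hausdorff space in which [K] is not closed
    ([open_ultra_limits]).  Being n-Urysohn, [K] cannot have two open
    ultrafilters with a common limit but different sets of limits: the common
    limit would lie in the closures of all neighbourhoods of n distinct points
    ([limits_agree]).  Call two points linked when all their
    neighbourhoods meet, that is, when some open ultrafilter converges to both.
    Then [K] is a Urysohn space with every point replaced by fewer than n
    mutually linked ones: unlinked points have neighbourhoods with disjoint
    closures ([unlinked_separated]), each closed neighbourhood of a point is a
    neighbourhood of the points linked to it ([linked_closure]), and n distinct
    points are never linked to a single one ([linked_bound]).  Moreover finitely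
    many of the closures of any assignment of neighbourhoods cover [K]
    ([finite_closure_cover]).  These facts make the closing-off argument for
    H-closed Urysohn spaces work: a set closed under limits of kappa-sequences
    and under choosing a point outside a union of closed basic neighbourhoods
    meets every class of linked points ([tree_point_linked]).  The least such
    set is the image of a type of well-founded kappa-branching trees, and a tree
    is determined by the labels found along finite sequences of branches, so no
    transfinite recursion is needed to bound its size ([tree_card_le]).  Hence
    [K] injects into [kappa -> lambda] ([n_H_closed_card_le]).

    Global part.  The neighbourhoods with n-H-closed closure cover [X]; lambda
    of them have a dense union, of size at most
    lambda * lambda ^ kappa = lambda ^ kappa.  In an n-Urysohn space fewer than
    n points can be approximated from a dense set by the same kappa-sequence, so
    [X] is no larger ([dense_card_le]).

    The cardinal arithmetic rests on the fact that the finite sequences in an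
    infinite set are no more numerous than its elements ([seq_card_le]), proved
    by Zorn's lemma. *)

Set Implicit Arguments.
Unset Strict Implicit.
Unset Printing Implicit Defensive.
Local Open Scope classical_set_scope.
Local Open Scope card_scope.

Local Notation cle K L := ([set: K] #<= [set: L]).

(** * Cardinal arithmetic *)

Lemma injective_left_inverse (T U : Type) (t0 : T) (f : T -> U) :
  injective f -> exists g : U -> T, cancel f g.
Proof.
move=> fi; have /choice[g gP] u : exists t, forall t', f t' = u -> t = t'.
  have [[t ft]|nt] := pselect (exists t, f t = u).
    by exists t => t'; rewrite -ft => /fi.
  by exists t0 => t' ft'; case: nt; exists t'.
by exists g => t; exact: gP.
Qed.

Lemma card_le_fun (T U : Type) (u0 : U) (A : set T) (B : set U) : A #<= B ->
  exists2 f : T -> U, (forall x, A x -> B (f x)) &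
    forall x y, A x -> A y -> f x = f y -> x = y.
Proof.
move=> AB; have /setT_card_leP[g ginj] : cle (set_type A) (set_type B).
  by rewrite (card_le_eql (card_setT _)) (card_le_eqr (card_setT _)).
exists (fun x => if pselect (A x) is left Ax then val (g (SigSub (mem_set Ax)))
                 else u0) => [x|x y].
  by case: pselect => // Ax _; exact: set_mem (valP (g _)).
case: pselect => // Ax; case: pselect => // Ay _ _.
by move=> /val_inj/ginj/(congr1 val).
Qed.

(** Let [J] be an injection of the lists over [B] into [B], and [c] an injective
    coding of the elements of [A] by lists over [B].  Coding twice, first each
    letter and then the resulting list, injects the lists over [A] into [B]. *)
Lemma seq_code_inj (K L : Type) (A : set K) (B : set L) (J : seq L -> L)
    (c : K -> seq L) :
    (forall l, all (fun x => x \in B) l -> B (J l)) ->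
    (forall l l', all (fun x => x \in B) l -> all (fun x => x \in B) l' ->
       J l = J l' -> l = l') ->
    (forall x, A x -> all (fun x => x \in B) (c x)) ->
    (forall x y, A x -> A y -> c x = c y -> x = y) ->
  forall l l', all (fun x => x \in A) l -> all (fun x => x \in A) l' ->
    J (map (J \o c) l) = J (map (J \o c) l') -> l = l'.
Proof.
move=> JB Jinj cB cinj.
have mB l : all (fun x => x \in A) l -> all (fun x => x \in B) (map (J \o c) l).
  rewrite all_map; elim: l => //= x l IHl /andP[/set_mem Ax /IHl ->].
  by rewrite mem_set //; exact/JB/cB.
move=> l l' Al Al' /(Jinj _ _ (mB _ Al) (mB _ Al')) {mB}.
elim: l l' Al Al' => [|x l IHl] [|y l'] //= /andP[/set_mem Ax Al].
move=> /andP[/set_mem Ay Al'] [/(Jinj _ _ (cB _ Ax) (cB _ Ay))/cinj-> //].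
by move=> /(IHl _ Al Al') ->.
Qed.

(** Zorn's lemma is applied to injections, given by their graphs [R], of the
    nonempty lists over a subset [fld R] of [K] into [fld R].  Nonempty lists
    are used so that the empty graph is one of them.  A maximal [R] with field
    [A] admits no extension with values in a nonempty set [B] disjoint from [A]
    ([noext]); so [A] is nonempty, as [K] contains a copy of [nat], and [~` A]
    is no larger than [A], whence [K] itself is coded by lists over [A]. *)
Lemma seq_card_le (K : Type) : infinite_set [set: K] -> cle (seq K) K.
Proof.
move=> /infiniteP/setT_card_leP[e einj].
pose fld (R : set (seq K * K)) := [set x | exists y, R ([:: x], y)].
pose over (A : set K) l := all (fun x => x \in A) l.
pose P (R : set (seq K * K)) :=
  [/\ forall l x y, R (l, x) -> R (l, y) -> x = y,
      forall l l' x, R (l, x) -> R (l', x) -> l = l',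
      forall l x, R (l, x) -> over (fld R) l /\ fld R x
    & forall a l, over (fld R) (a :: l) -> exists x, R (a :: l, x)].
have overS (A B : set K) l : A `<=` B -> over A l -> over B l.
  by move=> AB; apply: sub_all => x /set_mem/AB; exact: mem_set.
have fldS (R S : set (seq K * K)) : R `<=` S -> fld R `<=` fld S.
  by move=> RS x [y /RS]; exists y.
have [F FP Ftot|R [[Rf Ri Ro Rt] Rmax]] := @Zorn_bigcup _ P.
  split.
  - move=> l x y [S FS Sx] [S' FS' S'y]; have [SS|SS] := Ftot _ _ FS FS'.
      by have [Sf _ _ _] := FP _ FS'; exact: Sf (SS _ Sx) S'y.
    by have [Sf _ _ _] := FP _ FS; exact: Sf Sx (SS _ S'y).
  - move=> l l' x [S FS Sx] [S' FS' S'x]; have [SS|SS] := Ftot _ _ FS FS'.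
      by have [_ Si _ _] := FP _ FS'; exact: Si (SS _ Sx) S'x.
    by have [_ Si _ _] := FP _ FS; exact: Si Sx (SS _ S'x).
  - move=> l x [S FS Sx]; have [_ _ /(_ _ _ Sx)[Sl Sfx] _] := FP _ FS.
    have SF : S `<=` \bigcup_(X in F) X by move=> p Sp; exists S.
    by split; [exact: overS (fldS _ _ SF) Sl|exact: fldS SF _ Sfx].
  - move=> a l Fal; suff [S FS Sal] : exists2 S, F S & over (fld S) (a :: l).
      have [_ _ _ /(_ _ _ Sal)[x Sx]] := FP _ FS.
      by exists x; exists S.
    elim: l a Fal => [|b l IHl] a /=; rewrite ?andbT.
      move=> /set_mem[x [S FS Sx]]; exists S; rewrite // /over/= andbT mem_set //.
      by exists x.
    move=> /andP[/set_mem[x [S FS Sx]] /IHl[S' FS' S'bl]].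
    have Sa : fld S a by exists x.
    have [SS|SS] := Ftot _ _ FS FS'; [exists S'|exists S] => //.
      by rewrite /over/= (mem_set (fldS _ _ SS _ Sa)).
    by apply/andP; split; [exact: mem_set|apply: overS S'bl; exact: fldS].
set A := fld R in Ro Rt.
(* The lists over [A `|` B] that are not lists over [A] are sent by [g]. *)
have noext (B : set K) (b : K) (g : seq K -> K) : B b -> B `<=` ~` A ->
    (forall l, over (A `|` B) l -> B (g l)) ->
    (forall l l', over (A `|` B) l -> over (A `|` B) l' ->
       g l = g l' -> l = l') ->
    False.
  move=> Bb BA gB ginj.
  pose S := R `|` [set p | [/\ over (A `|` B) p.1, ~ over A p.1 & p.2 = g p.1]].
  have RS : R `<=` S by left.
  have BS x : B x -> S ([:: x], g [:: x]).
    move=> Bx; right; split=> //=.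
      by rewrite /over/= andbT; apply/mem_set; right.
    by rewrite /over/= andbT => /set_mem; exact: BA.
  have fldSE : fld S = A `|` B.
    rewrite eqEsubset; split=> [x [y [Rxy|[/=]]]|x [Ax|Bx]].
    - by left; exists y.
    - by rewrite /over/= andbT => /set_mem.
    - exact: fldS RS _ Ax.
    - by exists (g [:: x]); exact: BS.
  apply: (Rmax S).
    split=> // /(_ _ (BS _ Bb)) Rb; apply: (BA _ Bb); by exists (g [:: b]).
  split.
  - move=> l x y [Rx|[/= _ nA ->]] [Ry|[/= _ nA' ->]] //; first exact: Rf Rx Ry.
    + by have [] := Ro _ _ Rx.
    + by have [] := Ro _ _ Ry.
  - move=> l l' x [Rx|[/= Al nA xE]] [Rx'|[/= Al' nA' xE']].
    + exact: Ri Rx Rx'.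
    + by have [_ Ax] := Ro _ _ Rx; case: (BA (g l')); [exact: gB|rewrite -xE'].
    + by have [_ Ax] := Ro _ _ Rx'; case: (BA (g l)); [exact: gB|rewrite -xE].
    + by apply: ginj => //; rewrite -xE -xE'.
  - rewrite fldSE => l x [Rx|[/= Al nA ->]].
      by have [Al Ax] := Ro _ _ Rx; split; [apply: overS Al; left|left].
    by split=> //; right; exact: gB.
  - rewrite fldSE => a l Sal; have [Aal|nAal] := pselect (over A (a :: l)).
      by have [x Rx] := Rt _ _ Aal; exists x; left.
    by exists (g (a :: l)); right.
have [[a0 Aa0]|A0] := pselect (A !=set0); last first.
  have [e' eK] := injective_left_inverse 0%N einj.
  case: (@noext (range e) (e 0%N) (fun l => e (pickle (map e' l)))).
  - by exists 0%N.
  - by move=> x _ Ax; apply: A0; exists x.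
  - by move=> l _; exists (pickle (map e' l)).
  have mapK l : over (A `|` range e) l -> map e (map e' l) = l.
    elim: l => //= x l IHl /andP[/set_mem xe /IHl ->].
    by case: xe => [Ax|[m _ <-]]; [case: A0; exists x|rewrite eK].
  move=> l l' /mapK {2}<- /mapK {2}<- /einj /(pcan_inj (@pickleK _)).
  by move=> ->.
have [rho rhoP] : exists rho : seq K -> K,
    forall a l, over A (a :: l) -> R (a :: l, rho (a :: l)).
  have /choice[rho rhoP] l : exists x, (exists x', R (l, x')) -> R (l, x).
    by have [[x Rx]|nx] := pselect (exists x, R (l, x)); [exists x|exists a0].
  by exists rho => a l /Rt; exact: rhoP.
(* Prefixing by [a0] makes all lists over [A], the empty one included,
   arguments of [R]. *)
pose J l := rho (a0 :: l).
have a0l l : over A l -> over A (a0 :: l) by move=> Al; rewrite /over/= mem_set.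
have JA l : over A l -> A (J l).
  by move=> /a0l/rhoP Rl; have [] := Ro _ _ Rl.
have Jinj l l' : over A l -> over A l' -> J l = J l' -> l = l'.
  move=> /a0l/rhoP + /a0l/rhoP + JJ; rewrite /J in JJ; rewrite JJ.
  by move=> Rl /(Ri _ _ _ Rl)[].
have coding (B : set K) (phi : K -> K) : B `<=` ~` A ->
    (forall x, B x -> A (phi x)) ->
    (forall x y, B x -> B y -> phi x = phi y -> x = y) ->
    exists g : seq K -> K, (forall l, over (A `|` B) l -> A (g l)) /\
    (forall l l', over (A `|` B) l -> over (A `|` B) l' ->
       g l = g l' -> l = l').
  move=> BA phiA phii.
  (* Lists of length one and two tell the elements of [A] from those of [B]. *)
  pose c x := if pselect (A x) then [:: x] else [:: phi x; phi x].
  have cA x : (A `|` B) x -> over A (c x).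
    rewrite /c /over => -[Ax|Bx]; case: pselect => //= Ax'.
    - by rewrite mem_set.
    - by rewrite mem_set.
    - by rewrite mem_set //; exact: phiA.
  exists (fun l => J (map (J \o c) l)); split=> [l ABl|].
    apply: (JA); elim: l ABl => //= x l IHl /andP[/set_mem xAB /IHl ->].
    by rewrite mem_set //; exact: JA (cA _ xAB).
  apply: (@seq_code_inj _ _ _ A) => // x y ABx ABy; rewrite /c.
  case: pselect => Ax; case: pselect => Ay //; first by case.
  by case=> /phii xy _; apply: xy; [case: ABx|case: ABy].
have [AC|CA] : A #<= ~` A \/ ~` A #<= A.
- have := setT_card_le_total (set_type A) (set_type (~` A)).
  by rewrite (card_le_eql (card_setT _)) (card_le_eqr (card_setT _))
    (card_le_eql (card_setT (~` A))) (card_le_eqr (card_setT A)).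
- have [f fC fi] := card_le_fun a0 AC.
  have [phi phiP] : exists phi : K -> K, forall x, A x -> phi (f x) = x.
    pose Q k z := (exists2 x, A x & f x = k) -> A z /\ f z = k.
    have /choice[phi phiP] k : exists z, Q k z.
      by have [[m Am fm]|nm] := pselect (exists2 m, A m & f m = k);
        [exists m|exists a0].
    exists phi => x Ax; have [] := phiP (f x); first by exists x.
    by move=> Ap; exact: fi.
  have [| | |g [gA gi]] := @coding (f @` A) phi.
  - by move=> _ [x Ax <-]; exact: fC.
  - by move=> _ [x Ax <-]; rewrite phiP.
  - by move=> _ _ [x Ax <-] [y Ay <-]; rewrite !phiP // => ->.
  case: (@noext (f @` A) (f a0) (f \o g)).
  - by exists a0.
  - by move=> _ [x Ax <-]; exact: fC.
  - by move=> l /gA Agl; exists (g l).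
  - move=> l l' ol ol' /fi gg; apply: gi => //; apply: gg; exact: gA.
have [phi phiA phii] := card_le_fun a0 CA.
have [//|//|//|g [gA gi]] := @coding (~` A) phi.
have ov l : over (A `|` ~` A) l.
  by rewrite /over setUv; elim: l => //= x l ->; rewrite in_setT.
by apply/setT_card_leP; exists g => l l'; exact: gi.
Qed.

(** The powers [K -> L] of an infinite cardinal [L] by an infinite cardinal [K]
    absorb products, options and further powers by [K]. *)
Section FunctionCardinals.

Lemma fun_card_ler (A L M : Type) : cle L M -> cle (A -> L) (A -> M).
Proof.
move=> /setT_card_leP[g ginj]; apply/setT_card_leP; exists (fun f => g \o f).
by move=> f f' ff; apply/funext => a; apply: ginj; exact: (congr1 (@^~ a) ff).
Qed.

Lemma fun_card_lel (A B L : Type) (l0 : L) :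
  cle A B -> cle (A -> L) (B -> L).
Proof.
move=> /setT_card_leP[g ginj].
have [h hK] : exists h : B -> option A, forall a, h (g a) = Some a.
  have /choice[h hP] b : exists o, forall a, g a = b -> o = Some a.
    have [[a ga]|na] := pselect (exists a, g a = b).
      by exists (Some a) => a'; rewrite -ga => /ginj ->.
    by exists None => a ga; case: na; exists a.
  by exists h => a; exact: hP.
apply/setT_card_leP; exists (fun f b => if h b is Some a then f a else l0).
move=> f f' ff; apply/funext => a.
by have := congr1 (@^~ (g a)) ff; rewrite hK.
Qed.

Lemma curry_card_le (A B L : Type) : cle (A -> B -> L) (A * B -> L).
Proof.
apply/setT_card_leP; exists (fun f p => f p.1 p.2) => f f' ff.
by apply/funext => a; apply/funext => b; exact: (congr1 (@^~ (a, b)) ff).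
Qed.

Lemma prod_card_le (A A' B B' : Type) :
  cle A A' -> cle B B' -> cle (A * B) (A' * B').
Proof.
move=> /setT_card_leP[f fi] /setT_card_leP[g gi]; apply/setT_card_leP.
by exists (fun p => (f p.1, g p.2)) => -[a b] [a' b'] [/fi-> /gi->].
Qed.

Lemma option_card_le (A B : Type) : cle A B -> cle (option A) (option B).
Proof.
move=> /setT_card_leP[f fi]; apply/setT_card_leP; exists (omap f).
by move=> [a|] [a'|] //= [/fi->].
Qed.

Variables (K L : Type).
Hypotheses (Kinf : infinite_set [set: K]) (Linf : infinite_set [set: L]).

Lemma natK_card_le : cle nat K. Proof. exact/infiniteP. Qed.

Let l01 : exists l : bool -> L, injective l.
Proof.
have /infiniteP/setT_card_leP[l li] := Linf; exists (l \o nat_of_bool).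
by move=> [] [] // /li.
Qed.

Lemma square_card_le : cle (K * K) K.
Proof.
apply: card_le_trans (seq_card_le Kinf); apply/setT_card_leP.
by exists (fun p => [:: p.1; p.2]) => -[a b] [a' b'] [-> ->].
Qed.

Lemma fun_fun_card_le : cle (K -> K -> L) (K -> L).
Proof.
have [l _] := l01; apply: card_le_trans (curry_card_le _ _ _) _.
exact: fun_card_lel (l true) square_card_le.
Qed.

Lemma exponent_card_le : cle K (K -> L).
Proof.
have [l li] := l01; apply/setT_card_leP.
exists (fun k k' => l `[< k = k' >]) => k k' /(congr1 (@^~ k')) /li.
by rewrite (asboolT (erefl k')) => /asboolP.
Qed.

Lemma base_card_le : cle L (K -> L).
Proof.
have /setT_card_leP[e _] := natK_card_le; apply/setT_card_leP.
by exists (fun l _ => l) => l l' /(congr1 (@^~ (e 0%N))).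
Qed.

Lemma fun_prod_card_le : cle ((K -> L) * (K -> L)) (K -> L).
Proof.
have /setT_card_leP[e ei] := natK_card_le; have [l _] := l01.
apply: card_le_trans fun_fun_card_le.
have bK : cle bool K.
  by apply/setT_card_leP; exists (e \o nat_of_bool) => -[] [] // /ei.
apply: card_le_trans (fun_card_lel (fun=> l true) bK).
apply/setT_card_leP; exists (fun p b => if b then p.1 else p.2).
move=> [f g] [f' g'] fg; have /= -> := congr1 (@^~ true) fg.
by have /= -> := congr1 (@^~ false) fg.
Qed.

Lemma fun_option_card_le : cle (option (K -> L)) (K -> L).
Proof.
have [l li] := l01; have /setT_card_leP[e _] := natK_card_le.
apply: card_le_trans fun_prod_card_le; apply/setT_card_leP.
exists (fun o => if o is Some f then ((fun=> l true), f)
                 else ((fun=> l false), (fun=> l true))).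
move=> [f|] [g|] //=; first by case=> ->.
  by case=> /(congr1 (@^~ (e 0%N)))/li.
by case=> /(congr1 (@^~ (e 0%N)))/li.
Qed.

End FunctionCardinals.

Lemma bigcup_card_le (T U W : Type) (u0 : U) (w0 : W) (V : set (set T)) :
  V #<= [set: U] -> (forall A, V A -> A #<= [set: W]) ->
  \bigcup_(A in V) A #<= [set: U * W].
Proof.
move=> /(card_le_fun u0)[f _ fi] VW.
have /choice[g gi] A : exists g : T -> W, V A ->
    forall x y, A x -> A y -> g x = g y -> x = y.
  have [VA|nVA] := pselect (V A); last by exists (fun=> w0).
  by have [g _ gi] := card_le_fun w0 (VW _ VA); exists g.
have /choice[c cP] x : exists A, (\bigcup_(A in V) A) x -> V A /\ A x.
  have [[A VA Ax]|nx] := pselect ((\bigcup_(A in V) A) x); first by exists A.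
  by exists set0.
have [h] : $|{injfun \bigcup_(A in V) A >-> [set: U * W]}|.
  apply: injfunPex.2; exists (fun x => (f (c x), g (c x) x)) => // x y xV yV.
  have [[Vx xc] [Vy yc]] := (cP x (set_mem xV), cP y (set_mem yV)).
  move=> [/(fi _ _ Vx Vy) cc]; rewrite -cc in yc *; exact: gi.
exact: inj_card_le h.
Qed.

(** A map that takes no value at [n] distinct points has finite fibres. *)
Lemma finite_fibers_card_le (X : choiceType) (Z : Type) (n : nat) (f : X -> Z) :
  (forall s : seq X, uniq s -> size s = n ->
     ~ exists z, forall x, x \in s -> f x = z) ->
  cle X (Z * nat).
Proof.
move=> fib; have fin z : finite_set (f @^-1` [set z]).
  apply: contrapT => /(infinite_set_fset n)[B Bz nB].
  have := @fib (take n (finmap.enum_fset B)); apply.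
  - by rewrite take_uniq ?finmap.fset_uniq.
  - by rewrite size_takel.
  - by exists z => x /mem_take; exact: Bz.
have /choice[g gi] z : exists g : X -> nat, {in f @^-1` [set z] &, injective g}.
  exact/pcard_injP/finite_set_countable.
apply/setT_card_leP; exists (fun x => (f x, g (f x) x)) => x y [fxy gxy].
by apply: (gi (f y)); rewrite ?inE /= -?fxy // gxy -fxy.
Qed.

(** * Separation of finite families of points *)

(** The points listed in [s] have open neighbourhoods with empty intersection.
    The assignment [U] is total, and only its values on [s] matter. *)
Definition hausdorff_separated (X : topologicalType) (s : seq X) :=
  exists2 U : X -> set X, (forall a, open_nbhs a (U a)) &
    forall x, exists2 a, a \in s & ~ U a x.

(** The same with the closures of the neighbourhoods. *)
Definition urysohn_separated (X : topologicalType) (s : seq X) :=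
  exists2 U : X -> set X, (forall a, open_nbhs a (U a)) &
    forall x, exists2 a, a \in s & ~ closure (U a) x.

Lemma uniq_card_le (T : choiceType) (s : seq T) : uniq s ->
  `I_(size s) #<= [set` s].
Proof.
case: s => [|x0 s] us; first by rewrite II0 card_ge0.
have [h] : $|{injfun `I_(size (x0 :: s)) >-> [set` x0 :: s]}|.
  apply: injfunPex.2; exists (nth x0 (x0 :: s)) => [i /= si|i j].
    by rewrite mem_nth.
  by rewrite !inE => si sj /eqP; rewrite nth_uniq // => /eqP.
exact: inj_card_le h.
Qed.

(** With [C] the identity or the closure, this passes from a family defined on
    the points of [s] to a total one. *)
Lemma separating_family (X : topologicalType) (C : set X -> set X) (s : seq X)
    (V : X -> set X) :
  (forall a, [set` s] a -> open_nbhs a (V a)) ->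
  \bigcap_(a in [set` s]) C (V a) = set0 ->
  exists2 U : X -> set X, (forall a, open_nbhs a (U a)) &
    forall x, exists2 a, a \in s & ~ C (U a) x.
Proof.
move=> Vo V0; exists (fun a => if a \in s then V a else setT) => [a|x].
  by case: ifPn => [sa|_]; [exact: Vo|exact: open_nbhsT].
apply: contrapT => nx; suff : (\bigcap_(a in [set` s]) C (V a)) x by rewrite V0.
by move=> a /= sa; apply: contrapT => nCx; apply: nx; exists a; rewrite ?sa.
Qed.

Lemma n_HausdorffP (n : nat) (X : topologicalType) : (0 < n)%N ->
  n_Hausdorff n X <->
  forall s : seq X, uniq s -> size s = n -> hausdorff_separated s.
Proof.
move=> n0; have [Hb Hmin] := hausdorff_numberP X; split=> [HX s us sn|sep].
  have [|V Vo V0] := Hb [set` s].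
    by apply: card_le_trans HX _; rewrite -sn; exact: uniq_card_le.
  exact: (separating_family (C := id) Vo V0).
have eIn := @card_II n; apply: card_le_trans (Hmin 'I_n _) _; last first.
  by rewrite (card_le_eqr eIn).
move=> A nA; have [A0|/set0P[x0 Ax0]] := eqVneq A set0; last first.
  have [f fA fi] := card_le_fun x0 nA.
  have [||U Uo Us] := sep (map f (enum 'I_n)).
  - by rewrite map_inj_uniq ?enum_uniq // => i j; exact: fi.
  - by rewrite size_map size_enum_ord.
  exists U => [a _|]; first exact: Uo.
  rewrite -subset0 => x Ux; have [_ /mapP[i _ ->] []] := Us x.
  exact/Ux/fA.
by move: nA; rewrite A0 card_le0 => /eqP/seteqP[/(_ (Ordinal n0) I)].
Qed.

Lemma n_Urysohn_separated (n : nat) (X : topologicalType) : n_Urysohn n X ->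
  forall s : seq X, uniq s -> size s = n -> urysohn_separated s.
Proof.
move=> UX s us sn; have [Ub _] := urysohn_numberP X.
have [|V Vo V0] := Ub [set` s].
  by apply: card_le_trans UX _; rewrite -sn; exact: uniq_card_le.
exact: separating_family Vo V0.
Qed.

(** * The one-point extension by a filter *)

(** [X] together with a new point [None], whose neighbourhoods are those sets
    containing it whose trace on [X] contains an open member of [G].  The proof
    [GF] is a parameter because the topology depends on it. *)
Definition point_ext (X : Type) (G : set_system X) (GF : Filter G) : Type :=
  option X.

Section PointExtension.
Variables (X : topologicalType) (G : set_system X) (GF : Filter G).
Local Notation Y := (point_ext GF).

HB.instance Definition _ := Choice.on Y.

Definition ext_open : set (set Y) := [set O | open (@Some X @^-1` O) /\
  (O None -> G (@Some X @^-1` O))].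

Let ext_openT : ext_open setT.
Proof. by split=> [|_]; [exact: openT|exact: filterT]. Qed.

Let ext_openI : setI_closed ext_open.
Proof.
move=> A B [oA GA] [oB GB]; split=> [|[AN BN]]; first exact: openI.
by apply: filterI; [exact: GA|exact: GB].
Qed.

Let ext_open_bigU (I : Type) (f : I -> set Y) :
  (forall i, ext_open (f i)) -> ext_open (\bigcup_i f i).
Proof.
move=> fo; split=> [|[i _ /(fo i).2]].
  by rewrite preimage_bigcup; apply: bigcup_open => i _; have [] := fo i.
by apply: filterS => x fx; exists i.
Qed.

HB.instance Definition _ :=
  isOpenTopological.Build Y ext_openT ext_openI ext_open_bigU.

Lemma point_ext_openE (O : set Y) : open O <-> open (@Some X @^-1` O) /\
  (O None -> G (@Some X @^-1` O)).
Proof. by []. Qed.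

(** [W] as a set of points of [Y], with the new point added if [P] holds. *)
Definition lift_set (P : Prop) (W : set X) : set Y :=
  fun y => if y is Some x then W x else P.

Lemma point_ext_embedding : @embedding X Y (@Some X).
Proof.
split=> [x y [->] //|U]; split=> [oU|[V /point_ext_openE[oV _] ->] //].
exists (lift_set False U) => //; split=> //.
Qed.

(** If among any n - 1 points of [X] one is not in the adherence of the open
    members of [G], then adding the new point preserves being n-Hausdorff. *)
Lemma point_ext_n_Hausdorff (n : nat) : (0 < n)%N -> n_Hausdorff n X ->
  (forall s : seq X, uniq s -> size s = n.-1 ->
     exists x V W, [/\ x \in s, open_nbhs x V, open W, G W & V `&` W = set0]) ->
  n_Hausdorff n Y.
Proof.
move=> n0 /(n_HausdorffP _ n0) HX HG; apply/(n_HausdorffP _ n0) => s us sn.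
pose s' : seq X := pmap (fun y : Y => y) s.
have us' : uniq s' by apply: (@pmap_uniq _ _ _ Some) => // -[].
have ss' x : x \in s' -> Some x \in s by rewrite mem_pmap map_id.
have sizes' : (size s' + (None \in s))%N = n.
  rewrite size_pmap -sn -(count_predC (fun y : Y => y : bool)) -count_uniq_mem //.
  by congr addn; apply: eq_count => -[].
case: (boolP (None \in s)) sizes' => [sN|sN] /=; last first.
  rewrite addn0 => /(HX _ us')[U Uo Us].
  exists (fun y : Y => if y is Some x then lift_set False (U x) else setT).
    move=> [x|]; last exact: open_nbhsT.
    by have [oU Ux] := Uo x; split=> //; split.
  move=> [z|].
    by have [x /ss' sx nUz] := Us z; exists (Some x).
  have [[x|] sy] : exists y, y \in s.
    - by move: n0; rewrite -sn; case: (s) => // y r _; exists y; rewrite mem_head.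
    - by exists (Some x).
    - by rewrite sy in sN.
rewrite addn1 => ns.
have [|x [V [W [sx [oV Vx] oW GW VW]]]] := HG _ us'; first by rewrite -ns.
exists (fun y : Y => if y is Some z then
    if z == x then lift_set False V else setT else lift_set True W).
  move=> [z|]; last by split=> //; split.
  by case: eqP => [->|_]; [split=> //; split|exact: open_nbhsT].
move=> [z|]; last by exists (Some x); [exact: ss'|rewrite eqxx].
have [Wz|nWz] := pselect (W z); last by exists None.
exists (Some x); [exact: ss'|rewrite eqxx => /= Vz].
by suff : (V `&` W) z by rewrite VW.
Qed.

Lemma point_ext_not_closed : ~ G set0 -> ~ closed (range (@Some X : X -> Y)).
Proof.
move=> G0 /closed_openC/point_ext_openE[_ GN]; apply: G0.
by apply: filterS (GN _) => [x|[x]]//; apply; exists x.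
Qed.

End PointExtension.

(** * Open ultrafilters *)

(** An open ultrafilter, that is, a maximal filter of open sets, is represented
    by an ultrafilter of arbitrary sets that contains all dense open sets: its
    open members then form a maximal filter of open sets, by [open_ultraVC]. *)
Definition open_ultra (X : topologicalType) (G : set_system X) :=
  UltraFilter G /\ forall O, open O -> dense O -> G O.

Lemma open_ultra_sub (X : topologicalType) (F : set_system X) : Filter F ->
  (forall A, F A -> A° !=set0) ->
  exists2 G, open_ultra G & F `<=` G.
Proof.
move=> FF F0; pose D := [set p : set X * set X | [/\ F p.1, open p.2 & dense p.2]].
have FfF : Filter (filter_from D (fun p => p.1 `&` p.2)).
  apply: filter_from_filter.
    exists (setT, setT); split=> /=; [exact: filterT|exact: openT|].
    by move=> O O0 _; rewrite setIT.
  move=> [A B] [A' B'] [/= FA oB dB] [/= FA' oB' dB'].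
  exists (A `&` A', B `&` B') => /=; last by rewrite setIACA.
  by split=> /=; [exact: filterI|exact: openI|exact: denseI].
have PF : ProperFilter (filter_from D (fun p => p.1 `&` p.2)).
  apply: filter_from_proper => -[A B] [/= /F0 A0 oB dB].
  have [x [/interior_subset Ax Bx]] := dB _ A0 (open_interior A).
  by exists x.
have [G [GU sG]] := ultraFilterLemma PF.
exists G.
  split=> // O oO dO; apply: sG; exists (setT, O) => [|x []//].
  by split=> //=; exact: filterT.
move=> A FA; apply: sG; exists (A, setT) => [|x []//].
by split=> //=; [exact: openT|move=> O O0 _; rewrite setIT].
Qed.

(** The union of an open set with its exterior is open and dense. *)
Lemma open_ultraVC (X : topologicalType) (G : set_system X) (O : set X) :
  open_ultra G -> open O -> G O \/ G (~` closure O).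
Proof.
move=> [GU Gd] oO; have oC : open (~` closure O).
  exact/closed_openC/closed_closure.
have GD : G (O `|` ~` closure O).
  apply: Gd; first exact: openU.
  move=> A [x Ax] oA; apply: contrapT => nA; have Ox : ~ closure O x.
    move=> /(_ A (open_nbhs_nbhs (conj oA Ax)))[y [Oy Ay]].
    by apply: nA; exists y; split=> //; left.
  by apply: nA; exists x; split=> //; right.
have [GO|GnO] := in_ultra_setVsetC O GU; first by left.
right; apply: filterS (filterI GD GnO) => x [[|]//].
Qed.

Lemma open_ultra_limits (n : nat) (X : topologicalType) (G : set_system X) :
  (0 < n)%N -> n_H_closed n X -> open_ultra G ->
  exists s : seq X, [/\ uniq s, size s = n.-1 & forall x, x \in s -> G --> x].
Proof.
move=> n0 [HX clX] Gu; have [GU Gd] := Gu; apply: contrapT => nlim.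
have GF : Filter G by exact: filter_filter.
pose Y : topologicalType := point_ext GF.
apply: (@point_ext_not_closed X G GF); first exact: filter_not_empty.
apply: (clX Y); last exact: point_ext_embedding.
apply: point_ext_n_Hausdorff => // s us sn.
have [x sx nGx] : exists2 x, x \in s & ~ (G --> x).
  apply: contrapT => nx; apply: nlim; exists s; split=> // x sx.
  by apply: contrapT => nGx; apply: nx; exists x.
have [V xV nGV] : exists2 V, open_nbhs x V & ~ G V.
  apply: contrapT => nV; apply: nGx => A; rewrite /= nbhsE => -[V xV VA].
  by apply: filterS VA _; apply: contrapT => nGV; apply: nV; exists V.
exists x, V, (~` closure V); split=> //.
- exact/closed_openC/closed_closure.
- by have [] := open_ultraVC Gu xV.1.
- by rewrite -subset0 => y [/subset_closure].
Qed.

Lemma filter_bigcap_seq (T : Type) (I : eqType) (F : set_system T) (s : seq I)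
    (f : I -> set T) : Filter F -> (forall i, i \in s -> F (f i)) ->
  F (\bigcap_(i in [set` s]) f i).
Proof.
move=> FF; elim: s => [|i s IHs] Ff; first by apply: filterS filterT.
have FI : F (f i `&` \bigcap_(j in [set` s]) f j).
  apply: filterI; first exact: Ff (mem_head _ _).
  by apply: IHs => j sj; apply: Ff; rewrite in_cons sj orbT.
apply: filterS FI => x [fx sx] j /=; rewrite in_cons => /predU1P[->//|sj].
exact: sx.
Qed.

(** * Linked points in n-Urysohn n-H-closed spaces *)

Section UrysohnHClosed.
Variables (n : nat) (X : topologicalType).
Hypotheses (hn : (2 <= n)%N) (HX : n_H_closed n X).
Hypothesis (UX : forall s : seq X, uniq s -> size s = n -> urysohn_separated s).

Let n0 : (0 < n)%N := ltnW hn.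

Lemma open_ultra_meets (G : set_system X) (x : X) (A : set X) :
  open_ultra G -> G --> x -> G A -> closure A x.
Proof.
move=> [GU _] Gx GA B /Gx GB.
exact: (filter_ex (filterI GA GB)).
Qed.

(** A limit [z] of [G] that is not a limit of [G'] would form, with n - 1 limits
    of [G'], n distinct points; but [x] lies in the closure of any neighbourhood
    of each of these. *)
Lemma limits_agree (G G' : set_system X) (x z : X) :
  open_ultra G -> open_ultra G' -> G --> x -> G' --> x -> G --> z -> G' --> z.
Proof.
move=> Gu Gu' Gx Gx' Gz; have [s [us ss sG']] := open_ultra_limits n0 HX Gu'.
have [/sG' //|nsz] := boolP (z \in s).
have [||U Uo Us] := UX (s := z :: s); first by rewrite /= nsz.
  by rewrite /= ss prednK.
have [a sa []] := Us x; have aU := open_nbhs_nbhs (Uo a).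
move: sa; rewrite in_cons => /predU1P[az|/sG' G'a].
  by apply: (open_ultra_meets Gu) => //; apply: Gz; rewrite -az.
by apply: (open_ultra_meets Gu') => //; apply: G'a.
Qed.

(** [nbhs x `#` nbhs y], read as [x] and [y] being linked, says that every
    neighbourhood of [x] meets every neighbourhood of [y]. *)
Lemma linked_ultra (x y : X) : nbhs x `#` nbhs y ->
  exists2 G : set_system X, open_ultra G & G --> x /\ G --> y.
Proof.
move=> xy; pose D := [set p : set X * set X | nbhs x p.1 /\ nbhs y p.2].
have FF : Filter (filter_from D (fun p => p.1 `&` p.2)).
  apply: filter_from_filter.
    by exists (setT, setT); split; exact: filterT.
  move=> [A B] [A' B'] [/= xA yB] [/= xA' yB'].
  exists (A `&` A', B `&` B') => /=; last by rewrite setIACA.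
  by split; exact: filterI.
have [A [[B C] [/= xB yC] BCA]|G Gu sG] := open_ultra_sub FF.
  have [z [zB zC]] := xy _ _ (nbhs_interior xB) (nbhs_interior yC).
  exists z; apply: filterS BCA _; exact: filterI.
exists G => //; split=> A A'; apply: sG.
  by exists (A, setT) => [|z []//]; split=> //=; exact: filterT.
by exists (setT, A) => [|z []//]; split=> //=; exact: filterT.
Qed.

(** Otherwise some open ultrafilter converging to [y] contains the exterior of
    [V]; it also converges to [x], so it contains [V]. *)
Lemma linked_closure (x y : X) (V : set X) :
  nbhs x `#` nbhs y -> nbhs x V -> nbhs y (closure V).
Proof.
move=> xy xV; apply: contrapT => nyV.
have FF : Filter (filter_from (nbhs y) (fun B => B `&` ~` closure V)).
  apply: filter_from_filter; first by exists setT; exact: filterT.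
  move=> A B yA yB; exists (A `&` B); first exact: filterI.
  by move=> z [[Az Bz] nVz].
have [A [B yB BA]|G Gu sG] := open_ultra_sub FF.
  apply: contrapT => nA; apply: nyV; apply: filterS (nbhs_interior yB) => z Bz.
  apply: contrapT => nVz; apply: nA; exists z; apply: filterS BA _.
  apply: filterI => //; apply: open_nbhs_nbhs; split=> //.
  exact/closed_openC/closed_closure.
have [G' Gu' [Gx' Gy']] := linked_ultra xy.
have Gy : G --> y.
  by move=> A yA; apply: sG; exists A => // z [].
have [GU _] := Gu.
have Gx : G --> x by exact: (limits_agree Gu' Gu Gy' Gy Gx').
have GV : G (~` closure V).
  by apply: sG; exists setT; [exact: filterT|move=> z []].
have [z [/subset_closure Vz]] := filter_ex (filterI (Gx _ xV) GV).
exact.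
Qed.

(** The n - 1 limits of an open ultrafilter converging to [x] are linked to [x],
    hence distinct from [y].  Separating them together with [y] gives
    neighbourhoods whose closures are neighbourhoods of [x], and the
    intersection of those misses the closure of the neighbourhood of [y]. *)
Lemma unlinked_separated (x y : X) : ~ (nbhs x `#` nbhs y) ->
  exists V W, [/\ nbhs x V, nbhs y W & closure V `&` closure W = set0].
Proof.
move=> xy.
have [G Gu [Gx _]] : exists2 G : set_system X, open_ultra G & G --> x /\ G --> x.
  apply: linked_ultra => A B xA xB; exact: (filter_ex (filterI xA xB)).
have [s [us ss sG]] := open_ultra_limits n0 HX Gu.
have [GU _] := Gu.
have linked a : G --> a -> nbhs a `#` nbhs x.
  by move=> Ga A B /Ga GA /Gx GB; exact: (filter_ex (filterI GA GB)).
have nsy : y \notin s.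
  by apply/negP => /sG/linked; rewrite meetsC.
have [||U Uo Us] := UX (s := y :: s); first by rewrite /= nsy.
  by rewrite /= ss prednK.
exists (\bigcap_(a in [set` s]) closure (U a)), (U y); split.
- apply: filter_bigcap_seq => a sa.
  apply: linked_closure (open_nbhs_nbhs (Uo a)); exact/linked/sG.
- exact/open_nbhs_nbhs/Uo.
- rewrite -subset0 => z [sz Uz]; have [a asy nUz] := Us z.
  move: asy nUz; rewrite in_cons => /predU1P[->//|sa] nUz.
  apply: nUz; rewrite ((closure_id _).1 (@closed_closure _ (U a))).
  by apply: closureS sz => w; apply.
Qed.

Lemma linked_bound (x : X) (s : seq X) : uniq s -> size s = n ->
  ~ forall y, y \in s -> nbhs x `#` nbhs y.
Proof.
move=> us /(UX us)[U Uo Us] xs; have [y sy []] := Us x.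
move=> A xA; rewrite setIC; apply: xs sy _ _ xA _; exact/open_nbhs_nbhs.
Qed.

(** If no finite subfamily works, the complements of the closures generate an
    open filter; an open ultrafilter containing it has a limit [x], and
    contains both [O x] and its exterior. *)
Lemma finite_closure_cover (O : X -> set X) : (forall y, nbhs y (O y)) ->
  exists s : seq X, forall z, exists2 y, y \in s & closure (O y) z.
Proof.
move=> On; apply: contrapT => ns.
pose B (s : seq X) := \bigcap_(y in [set` s]) ~` closure (O y).
have FF : Filter (filter_from setT B).
  apply: filter_from_filter; first by exists [::].
  move=> s t _ _; exists (s ++ t) => // z stz.
  by split=> y sy; apply: stz; rewrite /= mem_cat sy ?orbT.
have [A [s _ BA]|G Gu sG] := open_ultra_sub FF.
  apply: contrapT => A0; apply: ns; exists s => z; apply: contrapT => nz.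
  apply: A0; exists z; apply: filterS BA _; apply: filter_bigcap_seq => y sy.
  apply: open_nbhs_nbhs; split; first exact/closed_openC/closed_closure.
  by move=> Oz; apply: nz; exists y.
have [s [us ss sGx]] := open_ultra_limits n0 HX Gu.
have [x sx] : exists x, x \in s.
  by case: (s) ss => [|x r _]; [case: (n) hn => [|[]]|exists x; rewrite mem_head].
have [GU _] := Gu.
have GB : G (~` closure (O x)).
  apply: sG; exists [:: x] => // z; apply; exact: mem_head.
have [z [/subset_closure Oz]] := filter_ex (filterI (sGx _ sx _ (On x)) GB).
exact.
Qed.

End UrysohnHClosed.

(** * Closing-off by well-founded trees *)

(** Terms for the points of the least set closed under two operations on
    [K]-sequences of points: one without parameter (label [None]) and one with a
    parameter in [K -> K]. *)
Inductive closing_tree (K : Type) : Type :=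
| Leaf
| Node of option (K -> K) & (K -> closing_tree K).

(** The label found in [t] at the address [l], if any; an address is a finite
    sequence of branches. *)
Fixpoint tree_code (K : Type) (t : closing_tree K) (l : seq K) :
    option (option (K -> K)) :=
  match t, l with
  | Leaf, _ => None
  | Node c _, [::] => Some c
  | Node _ f, k :: l' => tree_code (f k) l'
  end.

Lemma tree_code_inj (K : Type) : injective (@tree_code K).
Proof.
elim=> [|c f IHf] [|c' f'] // e; try by have := congr1 (@^~ [::]) e.
have [->] := congr1 (@^~ [::]) e; congr Node; apply/funext => k.
by apply: IHf; apply/funext => l; exact: (congr1 (@^~ (k :: l)) e).
Qed.

Lemma tree_card_le (K L : Type) : infinite_set [set: K] ->
  infinite_set [set: L] -> cle (closing_tree K) (K -> L).
Proof.
move=> Ki Li; have [l0 _] := infinite_setN0 Li.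
have KKL := card_le_trans (fun_card_ler K (exponent_card_le K Li))
  (fun_fun_card_le Ki Li).
have oKKL : cle (option (option (K -> K))) (K -> L).
  apply: card_le_trans (option_card_le (option_card_le KKL)) _.
  apply: card_le_trans (option_card_le (fun_option_card_le Ki Li)) _.
  exact: fun_option_card_le.
have codeT : cle (closing_tree K) (seq K -> option (option (K -> K))).
  apply/setT_card_leP; exists (@tree_code K); exact: tree_code_inj.
apply: card_le_trans codeT _.
apply: card_le_trans (fun_card_ler (seq K) oKKL) _.
apply: card_le_trans (fun_card_lel (fun=> l0) (seq_card_le Ki)) _.
exact: fun_fun_card_le.
Qed.

(** A family of local bases indexed by [K] at all points simultaneously, directed
    uniformly in the point: a refinement of two indices does not depend on [x].
    The uniformity lets a single [K]-sequence be compared at two points. *)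
Definition directed_base (X : topologicalType) (K : Type)
    (N : K -> X -> set X) :=
  [/\ forall k x, nbhs x (N k x),
      forall x A, nbhs x A -> exists k, N k x `<=` A
    & forall k k', exists k'', forall x, N k'' x `<=` N k x `&` N k' x].

Section ClosingOff.
Variables (n : nat) (X : topologicalType) (K L : Type) (N : K -> X -> set X).
Hypotheses (hn : (2 <= n)%N) (HX : n_H_closed n X).
Hypothesis (UX : forall s : seq X, uniq s -> size s = n -> urysohn_separated s).
Hypotheses (Ki : infinite_set [set: K]) (Li : infinite_set [set: L]).
Hypothesis (NX : directed_base N).

(** The value of a tree.  A node without parameter denotes a point having the
    [k]-th value in the closure of its [k]-th basic neighbourhood, for all [k];
    a node with parameter [g] denotes a point outside the closures of the
    [g k]-th basic neighbourhoods of the [k]-th values.  When there is no such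
    point the value is [x0], which is also the value of the leaf. *)
Fixpoint tree_point (x0 : X) (t : closing_tree K) : X :=
  match t with
  | Leaf => x0
  | Node None f =>
      xget x0 [set y | forall k, closure (N k y) (tree_point x0 (f k))]
  | Node (Some g) f =>
      xget x0 [set y | forall k, ~ closure (N (g k) (tree_point x0 (f k))) y]
  end.

Lemma linked_limit (x y : X) (f : K -> X) :
  (forall k, closure (N k x) (f k)) -> (forall k, closure (N k y) (f k)) ->
  nbhs x `#` nbhs y.
Proof.
have [_ Nb Nd] := NX; move=> fx fy; apply: contrapT.
move=> /(unlinked_separated hn HX UX)[V [W [/Nb[k kV] /Nb[k' kW] VW]]].
have [k'' kk] := Nd k k'.
suff : (closure V `&` closure W) (f k'') by rewrite VW.
split; first by apply: closureS (fx k''); move=> z /kk[/kV].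
by apply: closureS (fy k''); move=> z /kk[_ /kW].
Qed.

(** Suppose [q] is linked to no value of a tree.  A point [y] linked to some value
    [pt t] has as neighbourhood the closure of a basic neighbourhood of [pt t]
    that does not contain [q]; any other [y] has a neighbourhood whose closure
    contains no value, as otherwise [y] would be linked to a limit node.
    Finitely many closures of these cover [X], so those of the first kind cover
    all values; but a node with parameter denotes a value outside them, [q]
    showing that such points exist. *)
Lemma tree_point_linked (x0 q : X) :
  exists t, nbhs (tree_point x0 t) `#` nbhs q.
Proof.
apply: contrapT => /forallNP nq; have [Nn Nb Nd] := NX.
pose pt := tree_point x0.
have sepq t : exists k, ~ closure (N k (pt t)) q.
  apply: contrapT => /forallNP H; apply: (nq t) => A B /Nb[k kA] qB.
  have cl : closure (N k (pt t)) q by apply: contrapT; exact: H.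
  have [z [Nz Bz]] := cl _ qB.
  by exists z; split=> //; exact: kA.
have [k0 k0q] := sepq (Leaf K).
(* [k0] provides the pair [c] that is asked for, but irrelevant, in the second
   case. *)
have /choice[O OP] (y : X) : exists O, nbhs y O /\
    exists c : closing_tree K * K,
    ~ closure (N c.2 (pt c.1)) q /\
    ((forall z, closure O z -> closure (N c.2 (pt c.1)) z) \/
     (forall t, ~ closure O (pt t))).
  have [[t ty]|nt] := pselect (exists t, nbhs (pt t) `#` nbhs y).
    have [k kq] := sepq t; exists (closure (N k (pt t))).
    split; first exact: (linked_closure hn HX UX ty (Nn k (pt t))).
    exists (t, k); split=> //; left => z.
    by rewrite -((closure_id _).1 (@closed_closure _ (N k (pt t)))).
  suff [k ky] : exists k, forall t, ~ closure (N k y) (pt t).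
    by exists (N k y); split=> //; exists (Leaf K, k0); split=> //; right.
  apply: contrapT => nk.
  have /choice[f fy] k : exists t, closure (N k y) (pt t).
    by apply: contrapT => /forallNP kt; apply: nk; exists k.
  apply: nt; exists (Node None f); apply: linked_limit (fy) => k /=.
  have /= := @xgetI _ x0 [set y | forall k, closure (N k y) (pt (f k))] y fy.
  exact.
have On y : nbhs y (O y) by have [] := OP y.
have /choice[c cP] y := (OP y).2.
have [s sP] := finite_closure_cover hn HX On.
have /setT_card_leP[e ei] := natK_card_le Ki.
have [e' e'K] := injective_left_inverse 0%N ei.
(* The finite family is repeated so as to be indexed by [K]. *)
pose C k := c (nth q s (e' k)).
pose t := Node (Some (fun k => (C k).2)) (fun k => (C k).1).
have tP k : ~ closure (N (C k).2 (pt (C k).1)) (pt t).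
  have /= := @xgetI _ x0
    [set y | forall k, ~ closure (N (C k).2 (pt (C k).1)) y] q.
  by apply => k'; exact: (cP _).1.
have [y sy Oy] := sP (pt t); have [_ [cy|/(_ t)//]] := cP y.
apply: (tP (e (index y s))); rewrite /C e'K nth_index //; exact: cy.
Qed.

Lemma n_H_closed_card_le : cle X (K -> L).
Proof.
have [[x0 _]|X0] := pselect (exists x : X, True); last first.
  apply/setT_card_leP; exists (fun x => False_rect _ (X0 (ex_intro _ x I))) => x.
  by case: X0; exists x.
have /choice[r rP] := tree_point_linked x0.
apply: card_le_trans (@finite_fibers_card_le X (closing_tree K) n r _) _.
  move=> s us sn [t rt].
  apply: (linked_bound UX (x := tree_point x0 t) us sn) => y sy.
  by rewrite -(rt y sy).
apply: card_le_trans (prod_card_le (tree_card_le Ki Li) _) _; last first.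
  exact: fun_prod_card_le.
exact: card_le_trans (natK_card_le Ki) (exponent_card_le K Li).
Qed.

End ClosingOff.

(** * Local bases indexed by the character *)

(** Indices are first taken to be finite sequences in [K], with concatenation as
    refinement, and are then coded by elements of [K]. *)
Lemma character_directed_base (X : topologicalType) :
  exists N : character X -> X -> set X, directed_base N.
Proof.
set K := character X.
have [[Ki chiK] _] := characterP X; rewrite -/K in Ki chiK.
have [k0 _] := infinite_setN0 Ki.
have /choice[N0 N0P] (x : X) : exists N : K -> set X,
    (forall k, nbhs x (N k)) /\ forall A, nbhs x A -> exists k, N k `<=` A.
  have [[B [Bo Bb] BK] _] := character_atP x.
  have [f _ fi] := card_le_fun k0 (card_le_trans BK (chiK x)).
  have /choice[N NP] k : exists W, nbhs x W /\
      forall W', B W' -> f W' = k -> W = W'.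
    have [[W BW fW]|nW] := pselect (exists2 W, B W & f W = k).
      exists W; split; first exact/open_nbhs_nbhs/Bo.
      by move=> W' BW'; rewrite -fW => /fi->.
    exists setT; split; first exact: filterT.
    by move=> W' BW' fW'; case: nW; exists W'.
  exists N; split=> [k|A /Bb[W BW WA]]; first by have [] := NP k.
  by exists (f W); rewrite ((NP (f W)).2 W).
have /setT_card_leP[j ji] := seq_card_le Ki.
have [d dK] := injective_left_inverse [::] ji.
pose M l x := foldr (fun k A => N0 x k `&` A) setT l.
have Mcat l l' x : M (l ++ l') x = M l x `&` M l' x.
  by elim: l => /= [|k l ->]; [rewrite setTI|rewrite setIA].
exists (fun k => M (d k)); split.
- move=> k x; elim: (d k) => /= [|a l IHl]; first exact: filterT.
  by apply: filterI => //; exact: (N0P x).1.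
- move=> x A /(N0P x).2[k kA]; exists (j [:: k]).
  by rewrite dK /= setIT.
- by move=> k k'; exists (j (d k ++ d k')) => x; rewrite dK Mcat.
Qed.

(** The topology of [set_type A] is the relative one. *)
Lemma sub_urysohn_separated (n : nat) (X : topologicalType) (A : set X) :
  (forall s : seq X, uniq s -> size s = n -> urysohn_separated s) ->
  forall s : seq (set_type A), uniq s -> size s = n -> urysohn_separated s.
Proof.
move=> UX s us sn.
have [||U Uo Us] := UX (map val s).
- by rewrite map_inj_uniq //; exact: val_inj.
- by rewrite size_map.
exists (fun a => val @^-1` U (val a)) => [a|x].
  by have [oU Ua] := Uo (val a); split=> //; exists (U (val a)).
have [_ /mapP[a sa ->] nUa] := Us (val x); exists a => //.
apply: contra_not nUa => cl B xB.
have [y [Uy By]] := cl _ (@initial_continuous _ _ (@set_val _ A) x B xB).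
by exists (val y).
Qed.

Lemma sub_directed_base (X : topologicalType) (K : Type)
    (N : K -> X -> set X) (A : set X) : directed_base N ->
  @directed_base (set_type A) K (fun k z => val @^-1` N k (val z)).
Proof.
move=> [Nn Nb Nd]; split.
- by move=> k z; exact: (@initial_continuous _ _ (@set_val _ A) z _ (Nn k _)).
- move=> z B; rewrite nbhsE => -[_ [[V oV <-] Vz] VB].
  have [k kV] := Nb _ _ (open_nbhs_nbhs (conj oV Vz)).
  by exists k => w /kV; exact: VB.
- by move=> k k'; have [k'' kk] := Nd k k'; exists k'' => z w; exact: kk.
Qed.

(** * Bounding a space by a dense subset *)

(** Each point [x] is sent to a [K]-sequence whose [k]-th term is taken in [D] and
    in the [k]-th basic neighbourhood of [x]; n distinct points sharing a
    sequence could not be separated. *)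
Lemma dense_card_le (n : nat) (X : topologicalType) (K L : Type)
    (N : K -> X -> set X) (D : set X) : (0 < n)%N ->
  (forall s : seq X, uniq s -> size s = n -> urysohn_separated s) ->
  directed_base N -> infinite_set [set: K] -> infinite_set [set: L] ->
  closure D = setT -> D #<= [set: K -> L] -> cle X (K -> L).
Proof.
move=> n0 UX [Nn Nb Nd] Ki Li DT; have [l0 _] := infinite_setN0 Li.
move=> /(card_le_fun (fun=> l0))[d _ di].
have /choice[p pP] x : exists p : K -> X, forall k, D (p k) /\ N k x (p k).
  have Dx : closure D x by rewrite DT.
  have /choice[p pP] k : exists w, D w /\ N k x w by exact: Dx (Nn k x).
  by exists p.
apply: card_le_trans (@finite_fibers_card_le X (K -> K -> L) n
    (fun x k => d (p x k)) _) _.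
  move=> s us sn [f fP]; have [U Uo Us] := UX s us sn.
  have [k kU] : exists k, forall a, a \in s -> N k a `<=` U a.
    elim: (s) => [|a r [k kr]]; first by have [k _] := infinite_setN0 Ki; exists k.
    have [k' ka] := Nb _ _ (open_nbhs_nbhs (Uo a)); have [k'' kk] := Nd k k'.
    exists k'' => b; rewrite in_cons => /predU1P[-> z /kk[_ /ka]//|rb z /kk[]].
    by move=> + _; exact: kr.
  have [a0 sa0] : exists a, a \in s.
    by move: n0; rewrite -sn; case: (s) => // y r _; exists y; rewrite mem_head.
  have [a sa nUa] := Us (p a0 k).
  apply: nUa; apply: subset_closure; apply: (kU _ sa).
  have -> : p a0 k = p a k; last by have [] := pP a k.
  apply: di; [by have [] := pP a0 k|by have [] := pP a k|].
  by rewrite (congr1 (@^~ k) (fP _ sa0)) (congr1 (@^~ k) (fP _ sa)).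
apply: card_le_trans (prod_card_le (fun_fun_card_le Ki Li) _) _; last first.
  exact: fun_prod_card_le.
exact: card_le_trans (natK_card_le Ki) (exponent_card_le K Li).
Qed.

Theorem theorem4p20 (n : nat) (X : topologicalType) (hn : (2 <= n)%N)
    (hU : n_Urysohn n X) (hL : locally_n_H_closed n X) :
  [set: X] #<= [set: character X -> weak_lindelof_degree X].
Proof.
have UX := n_Urysohn_separated hU.
have [[Ki _] _] := characterP X.
have [[Li Lb] _] := weak_lindelof_degreeP X.
move: Ki Li Lb; set K := character X; set L := weak_lindelof_degree X.
move=> Ki Li Lb; have [l0 _] := infinite_setN0 Li.
have [N NX] := character_directed_base X.
have /choice[U UP] (x : X) : exists U : set X,
    open_nbhs x U /\ n_H_closed n (set_type (closure U)).
  by have [U] := hL x; exists U.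
have UK x : U x #<= [set: K -> L].
  have [_ HU] := UP x.
  apply: card_le_trans (subset_card_le (@subset_closure _ _)) _.
  rewrite -(card_le_eql (card_setT _)).
  apply: (n_H_closed_card_le hn HU _ Ki Li (sub_directed_base _ NX)).
  exact: sub_urysohn_separated.
have [||V [VU VL VT]] := Lb (range U).
- by move=> _ [x _ <-]; have [[]] := UP x.
- rewrite -subTset => x _; exists (U x); [by exists x|].
  by have [[]] := UP x.
apply: (dense_card_le (ltnW hn) UX NX Ki Li VT).
have VK A : V A -> A #<= [set: K -> L] by move=> /VU[x _ <-].
apply: card_le_trans (bigcup_card_le l0 (fun=> l0) VL VK) _.
apply: card_le_trans (prod_card_le (base_card_le L Ki) (card_lexx _)) _.
exact: fun_prod_card_le.
Qed.
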